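(* Let $d\ge 1$, $\delta\in(0,1]$, let $\mathcal{P}=(0,1)^{d+1}\subset\mathbb{R}^{d+1}=\mathbb{R}\times\mathbb{R}^d$, and let $a$ be an $\mathbb{S}_\delta$-valued function on $\mathcal{P}$ of class $BMO^{x}_{1}(\mathcal{P})$. Then there exists an $\mathbb{S}_\delta$-valued function $\hat a$ on $\mathbb{R}^{d+1}$ such that $$ \hat a=a\quad\text{on}\quad\mathcal{P},\qquad [\hat a]^{\sharp}_{\infty,\mathbb{R}^{d+1}}\le 3^{2+2d}\,[a]^{\sharp}_{1,\mathcal{P}}. $$
   Context: For $\delta\in(0,1]$, $\mathbb{S}_\delta$ is the set of symmetric $d\times d$ real matrices whose eigenvalues all lie in $[\delta,\delta^{-1}]$. For a matrix, $|\cdot|$ denotes the Euclidean (Frobenius) norm. Points of $\mathbb{R}^{d+1}=\mathbb{R}\times\mathbb{R}^d$ are written $(t,x)$ with $t\in\mathbb{R}$, $x\in\mathbb{R}^d$. Functions are Lebesgue measurable. For $\rho>0$, $\mathbb{C}_\rho$ denotes the collection of cubes $x+(0,\rho)^d$, $x\in\mathbb{R}^d$, and $\mathbb{Q}_\rho$ denotes the collection of parabolic boxes $Q=(s,s+\rho^2)\times C$ with $s\in\mathbb{R}$, $C\in\mathbb{C}_\rho$. For such $Q$ set $Q^{z}=(s,s+\rho^2)$ (the time interval) and $Q^{\tau}=C$ (the spatial cube). For a domain $\mathcal{O}\subset\mathbb{R}^{d+1}$, $\mathbb{Q}_\rho(\mathcal{O})$ is the collection of $Q\in\mathbb{Q}_\rho$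 with $Q\subset\mathcal{O}$. For a domain $\mathcal{O}\subset\mathbb{R}^{d+1}$, $\rho_0\in(0,\infty]$, and a (matrix-valued) function $a$ on $\mathcal{O}$, define $$ [a]^{\sharp}_{\rho_0,\mathcal{O}}:=\sup_{\rho\le\rho_0}\ \sup_{Q\in\mathbb{Q}_\rho(\mathcal{O})}\ \frac{1}{|Q^{z}|\,|Q^{\tau}|^2}\int_{Q^{z}}\int_{Q^{\tau}}\int_{Q^{\tau}}|a(t,x)-a(t,y)|\,dx\,dy\,dt, $$ where $\rho$ ranges over finite positive numbers and $|\cdot|$ of a set is Lebesgue measure. One writes $a\in BMO^{x}_{\rho_0}(\mathcal{O})$ if $[a]^{\sharp}_{\rho_0,\mathcal{O}}<\infty$. *)

(* Defs.v *)
From HB Require Import structures.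
From mathcomp Require Import all_boot all_order all_algebra.
From mathcomp Require Import all_classical all_reals all_analysis.

Set Implicit Arguments.
Unset Strict Implicit.
Unset Printing Implicit Defensive.

Import Order.TTheory GRing.Theory Num.Theory.
Import numFieldNormedType.Exports.

Local Open Scope classical_set_scope.
Local Open Scope ring_scope.

Section lebesgue_measure_tuple.
Context {R : realType}.

Local Notation rR := (measurableTypeR R).

Section cons.
Variable n : nat.

Definition cons_pair (p : rR * n.-tuple rR) : n.+1.-tuple rR :=
  [tuple of p.1 :: p.2].

Lemma measurable_cons_pair : measurable_fun [set: rR * n.-tuple rR] cons_pair.
Proof.
exact: (@measurable_cons _ _ _ _ fst n snd measurable_fst measurable_snd).
Qed.

Variable mu : {sigma_finite_measure set (n.-tuple rR) -> \bar R}.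

Definition cons_measure : set (n.+1.-tuple rR) -> \bar R :=
  pushforward (lebesgue_measure \x mu)%E cons_pair.

Let cons_measure0 : cons_measure set0 = 0%E.
Proof. by rewrite /cons_measure /pushforward preimage_set0 measure0. Qed.

Let cons_measure_ge0 A : (0 <= cons_measure A)%E.
Proof. by rewrite /cons_measure /pushforward; exact: measure_ge0. Qed.

Let cons_measure_sigma_additive : semi_sigma_additive cons_measure.
Proof.
move=> F mF tF mUF; rewrite /cons_measure /pushforward preimage_bigcup.
have mpre i : measurable (cons_pair @^-1` F i).
  by rewrite -[X in measurable X]setTI; exact: measurable_cons_pair.
apply: measure_semi_sigma_additive => //.
- apply/trivIsetP => /= i j _ _ ij; rewrite -preimage_setI.
  by move/trivIsetP : tF => /(_ _ _ _ _ ij) ->//; rewrite preimage_set0.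
- exact: bigcup_measurable.
Qed.

HB.instance Definition _ := isMeasure.Build _ _ _
  cons_measure cons_measure0 cons_measure_ge0 cons_measure_sigma_additive.

Let uncons (t : n.+1.-tuple rR) : rR * n.-tuple rR :=
  (thead t, [tuple of behead t]).

Let measurable_uncons : measurable_fun [set: n.+1.-tuple rR] uncons.
Proof.
apply/measurable_fun_pair => /=; first exact: measurable_tnth.
exact: measurable_behead.
Qed.

Let consK : cancel cons_pair uncons.
Proof.
by case=> x t; rewrite /uncons /cons_pair theadE; congr pair; apply: val_inj.
Qed.

Let cons_measure_sigma_finite : sigma_finite [set: n.+1.-tuple rR] cons_measure.
Proof.
have /sigma_finiteP[F [FT ndF Foo]] := sigma_finiteT (@lebesgue_measure R).
have /sigma_finiteP[G [GT ndG Goo]] := sigma_finiteT mu.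
exists (fun i => uncons @^-1` (F i `*` G i)) => [|i].
  apply/seteqP; split=> [t _|//].
  have [i _ Fi] : (\bigcup_i F i) (uncons t).1 by rewrite -FT.
  have [j _ Gj] : (\bigcup_j G j) (uncons t).2 by rewrite -GT.
  exists (maxn i j) => //; split.
    by move: (uncons t).1 Fi; exact/subsetPset/ndF/leq_maxl.
  by move: (uncons t).2 Gj; exact/subsetPset/ndG/leq_maxr.
have [mFi Fioo] := Foo i; have [mGi Gioo] := Goo i; split.
  rewrite -[X in measurable X]setTI; apply: measurable_uncons => //.
  exact: measurableX.
rewrite /cons_measure /pushforward -comp_preimage.
have -> : uncons \o cons_pair = id by apply: funext => p; exact: consK.
by rewrite preimage_id product_measure1E// lte_mul_pinfty// ge0_fin_numE.
Qed.

HB.instance Definition _ := @Measure_isSigmaFinite.Build _ _ _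
  cons_measure cons_measure_sigma_finite.

End cons.

(* Lebesgue measure on the Borel sets of R^n, as the n-fold product measure. *)
Fixpoint lebesgue_measure_tuple (n : nat) :
    {sigma_finite_measure set (n.-tuple rR) -> \bar R} :=
  match n with
  | 0 => dirac ([tuple] : 0.-tuple rR)
  | m.+1 => cons_measure (lebesgue_measure_tuple m)
  end.

End lebesgue_measure_tuple.

(* Lebesgue measure on the Lebesgue measurable subsets of R^d: the completion,
   by outer measures, of the Borel measure, as in [completed_lebesgue_measure]. *)
Definition completed_lebesgue_tuple (R : realType) (d : nat) :=
  @completed_measure_extension _ _ _ (@lebesgue_measure_tuple R d).
Arguments completed_lebesgue_tuple : clear implicits.

(* R * R^d with the sigma-algebra of its Lebesgue measurable sets. *)
Notation lebesgue_spacetime R d :=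
  (caratheodory_type
    ((@lebesgue_measure R \x @lebesgue_measure_tuple R d)%E^*)%mu).

Section bmo.
Context {R : realType} {d : nat}.
Implicit Types (delta rho s t : R) (x y : d.-tuple R) (A : 'M[R]_d).
Implicit Types (O : set (R * d.-tuple R)) (a : R * d.-tuple R -> 'M[R]_d).

Definition Sdelta delta : set 'M[R]_d :=
  [set A | A^T = A /\ forall l, eigenvalue A l -> delta <= l <= delta^-1].

Definition frobenius A : R := Num.sqrt (\sum_i \sum_j A i j ^+ 2).

Definition cube x rho : set (d.-tuple R) :=
  [set y | forall i, tnth x i < tnth y i < tnth x i + rho].

Definition time_interval s rho : set R := `]s, s + rho ^+ 2[.

Definition unit_cube : set (R * d.-tuple R) :=
  [set p | 0 < p.1 < 1 /\ forall i, 0 < tnth p.2 i < 1].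

Definition lebesgue_measurable_on O a : Prop :=
  forall i j, measurable_fun (O : set (lebesgue_spacetime R d))
    (fun p => a p i j : measurableTypeR R).

Definition mean_oscillation (Qz : set R) (Qt : set (d.-tuple R)) a : \bar R :=
  ((\int[completed_lebesgue_measure]_(t in Qz)
     \int[completed_lebesgue_tuple R d]_(y in Qt)
     \int[completed_lebesgue_tuple R d]_(x in Qt)
       (frobenius (a (t, x) - a (t, y)))%:E)
   / (completed_lebesgue_measure Qz * completed_lebesgue_tuple R d Qt ^+ 2))%E.

Definition sharp_seminorm (rho0 : \bar R) O a : \bar R :=
  ereal_sup [set m | exists rho s x,
    [/\ 0 < rho, (rho%:E <= rho0)%E,
        time_interval s rho `*` cube x rho `<=` O &
        m = mean_oscillation (time_interval s rho) (cube x rho) a]].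

Definition BMOx (rho0 : \bar R) O a : Prop :=
  (sharp_seminorm rho0 O a < +oo)%E.

End bmo.

(* Main.v *)
(** The coefficient is extended by reflection: [fold] is the even 2-periodic
    triangle wave that maps [R] onto [0, 1] and is an isometry between
    consecutive integers, and [ahat(t, x) = a(fold t, fold x)] off the points
    with an integer coordinate.  An interval [I] of length [rho] meets at most
    [m = floor rho + 2] unit cells, and on each of them [fold] sends [I] into one
    common interval of length [r = min(rho, 1)] of (0, 1).  So an integral over
    [I] of a folded function is at most [m] times the integral over the short
    interval, and [m r <= 3 rho]; for a box [Q] one gets the factor
    [3 ^ (1 + 2 d)].

    The iterated integrals in [mean_oscillation] need not have measurable
    integrands for every [t].  No Fubini argument is required: the library
    integral of an arbitrary nonnegative function is a lower integral, which is
    monotone, subadditive in the domain and invariant under measure-preserving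
    bijections. *)
Require Import Defs.
From mathcomp Require Import all_boot all_order all_algebra.
From mathcomp Require Import all_classical all_reals all_analysis.
From mathcomp Require Import measurable_realfun lra.

Import Order.TTheory GRing.Theory Num.Theory.
Import numFieldNormedType.Exports.

Set Implicit Arguments.
Unset Strict Implicit.
Unset Printing Implicit Defensive.

Local Open Scope classical_set_scope.
Local Open Scope ring_scope.

(** * Measure-preserving maps and completion *)

Section outer_measure_isometry.
Local Open Scope ereal_scope.
Context {dT : measure_display} {T : semiRingOfSetsType dT} {R : realType}.
Variable mu : {measure set T -> \bar R}.
Implicit Types phi psi : T -> T.

Lemma mu_ext_preimage_le phi :
  (forall F, measurable F -> (mu^*)%mu (phi @^-1` F) <= mu F) ->
  forall A, (mu^*)%mu (phi @^-1` A) <= (mu^*)%mu A.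
Proof.
move=> phile A; apply: le_ereal_inf_tmp => _ [F [mF AF] <-].
apply: (@le_trans _ _ ((mu^*)%mu (\bigcup_k (phi @^-1` F k)))).
  apply: (le_outer_measure (mu^*)%mu) => x /AF[k _ Fk]; by exists k.
apply: (le_trans (outer_measure_sigma_subadditive (mu^*)%mu _)).
by apply: lee_nneseries => // k _; exact: phile.
Qed.

Variables phi psi : T -> T.
Hypotheses (phiK : cancel phi psi) (psiK : cancel psi phi).
Hypothesis phile : forall F, measurable F -> (mu^*)%mu (phi @^-1` F) <= mu F.
Hypothesis psile : forall F, measurable F -> (mu^*)%mu (psi @^-1` F) <= mu F.

Let preimageK A : psi @^-1` (phi @^-1` A) = A.
Proof. by apply/seteqP; split => x; rewrite /preimage /= psiK. Qed.

Let preimageVK A : phi @^-1` (psi @^-1` A) = A.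
Proof. by apply/seteqP; split => x; rewrite /preimage /= phiK. Qed.

Lemma mu_ext_preimage A : (mu^*)%mu (phi @^-1` A) = (mu^*)%mu A.
Proof.
apply/eqP; rewrite eq_le mu_ext_preimage_le//=.
by rewrite -[X in _ X <= _](preimageK A) mu_ext_preimage_le.
Qed.

Lemma caratheodory_measurable_preimage A :
  (mu^*)%mu.-caratheodory A -> (mu^*)%mu.-caratheodory (phi @^-1` A).
Proof.
move=> mA X; rewrite -(preimageVK X) preimage_setC -!preimage_setI.
by rewrite !mu_ext_preimage; exact: mA.
Qed.

End outer_measure_isometry.

Definition measure_preserving {d} {T : measurableType d} {R : realType}
    (mu : set T -> \bar R) (phi : T -> T) :=
  measurable_fun setT phi /\
  forall A, measurable A -> mu (phi @^-1` A) = mu A.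

(** Measurability for the completion means the Caratheodory condition. It passes to preimages
    because the map and its inverse both preserve the outer measure. *)
Lemma completed_measure_preserving d (T : measurableType d) (R : realType)
    (mu : {measure set T -> \bar R}) (phi psi : T -> T) :
  cancel phi psi -> cancel psi phi ->
  measure_preserving mu phi -> measure_preserving mu psi ->
  measure_preserving (@completed_measure_extension _ _ _ mu)
    (phi : caratheodory_type (mu^*)%mu -> caratheodory_type (mu^*)%mu).
Proof.
move=> phiK psiK [mphi phiE] [mpsi psiE].
have le (f : T -> T) : measurable_fun setT f ->
    (forall A, measurable A -> mu (f @^-1` A) = mu A) ->
    forall F, measurable F -> ((mu^*)%mu (f @^-1` F) <= mu F)%E.
  move=> mf fE F mF; rewrite measurable_mu_extE ?fE//.
  by rewrite -[X in measurable X]setTI; exact: mf.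
have lephi := le _ mphi phiE; have lepsi := le _ mpsi psiE.
split=> [_ A mA|A mA]; last exact: (mu_ext_preimage psiK lephi lepsi).
rewrite setTI.
exact: (caratheodory_measurable_preimage phiK psiK lephi lepsi).
Qed.

(** * Reflections and translations of the line *)

Section reflection.
Context {R : realType}.

(** An isometry of the line: orientation reversing if [b] holds, otherwise a translation. One family
    serves both kinds of cells of the folding map. *)
Definition reflection (b : bool) (c u : R) : R := if b then c - u else u + c.

Lemma reflectionK b c :
  cancel (reflection b c) (reflection b (if b then c else - c)).
Proof. by case: b => u; rewrite /reflection ?addrK// subKr. Qed.

Lemma reflectionVK b c :
  cancel (reflection b (if b then c else - c)) (reflection b c).
Proof. by case: b => u; rewrite /reflection ?subrK// subKr. Qed.

Lemma measurable_reflection b c :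
  measurable_fun setT
    (reflection b c : measurableTypeR R -> measurableTypeR R).
Proof.
case: b; first exact: measurable_funB.
exact: measurable_funD.
Qed.

Lemma lebesgue_reflection b c :
  measure_preserving (@lebesgue_measure R) (reflection b c).
Proof.
have mr := measurable_reflection b c; split=> // A mA.
pose m : {measure set (measurableTypeR R) -> \bar R} :=
  pushforward (@lebesgue_measure R)
    (reflection b c : measurableTypeR R -> measurableTypeR R).
suff -> : lebesgue_measure A = m mr A by [].
apply: lebesgue_measure_unique => // _ [[a a'] _ <-] /=.
rewrite /m /= /pushforward.
(* Lebesgue measure is determined by the half-open intervals. Reversal moves the closed endpoint to
   the left, hence the two shapes. *)
have -> : reflection b c @^-1` `]a, a'] =
    [set` if b then `[c - a', c - a[ else `]a - c, a' - c]] :> set R.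
  apply/seteqP; split => u; rewrite /preimage /= /reflection !in_itv/=;
    case: (b); rewrite /= ?in_itv /=.
  - by rewrite ltrBrDr lerBlDr ltrBrDl lerBlDl addrC [u + a]addrC => /andP[-> ->].
  - by rewrite ltrBlDr lerBrDr.
  - by rewrite ltrBrDr lerBlDr ltrBrDl lerBlDl addrC [u + a]addrC => /andP[-> ->].
  - by rewrite ltrBlDr lerBrDr.
case: (b) => /=; rewrite !lebesgue_measure_itv/= !lte_fin -!EFinD.
  by rewrite ltrD2l ltrN2 opprB [c - a + _]addrC addrA subrK.
by rewrite ltrD2r opprB addrA subrK.
Qed.

(** [completed_lebesgue_measure] comes from the outer measure of the length on half-open intervals,
    not of the Borel measure, so the outer measure argument is repeated over that semiring. *)
Lemma completed_lebesgue_reflection b c :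
  measure_preserving (@completed_lebesgue_measure R) (reflection b c).
Proof.
have le b' c' (F : set (ocitv_type R)) : measurable F ->
   ((wlength idfun)^*%mu (reflection b' c' @^-1` F) <= wlength idfun F)%E.
  move=> mF.
  rewrite -[leLHS]/(lebesgue_measure (reflection b' c' @^-1` F)).
  have mF' : measurable (F : set (measurableTypeR R)).
    exact: sub_sigma_algebra.
  rewrite (lebesgue_reflection b' c').2// /lebesgue_measure.
  rewrite /lebesgue_stieltjes_measure /measure_extension measurable_mu_extE//.
split=> [_ A mA|A mA].
  rewrite setTI.
  exact: (@caratheodory_measurable_preimage _ (ocitv_type R) R (wlength idfun)
    _ _ (@reflectionK b c) (@reflectionVK b c) (le _ _) (le _ _) A mA).
exact: (@mu_ext_preimage _ (ocitv_type R) R (wlength idfun)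
  _ _ (@reflectionVK b c) (le _ _) (le _ _)).
Qed.

End reflection.

(** * Change of variables and product maps *)

Lemma ge0_integral_measure_preserving d (T : measurableType d) (R : realType)
    (mu : {measure set T -> \bar R}) (psi : T -> T) (g : T -> \bar R) :
  measure_preserving mu psi ->
  measurable_fun setT g -> (forall x, 0 <= g x)%E ->
  (\int[mu]_x g x = \int[mu]_x g (psi x))%E.
Proof.
move=> [mpsi psiE] mg g0.
transitivity (\int[pushforward mu psi]_x g x)%E.
  by apply: eq_measure_integral => A mA _; exact/esym/psiE.
by rewrite ge0_integral_pushforward// preimage_setT.
Qed.

(** The product measure integrates the measures of the sections: [f2] preserves each section's
    measure and [f1] the integral over the first factor. *)
Lemma measure_preserving_prod d1 d2 (T1 : measurableType d1)
    (T2 : measurableType d2) (R : realType)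
    (m1 : {measure set T1 -> \bar R})
    (m2 : {sigma_finite_measure set T2 -> \bar R})
    (f1 : T1 -> T1) (f2 : T2 -> T2) :
  measure_preserving m1 f1 -> measure_preserving m2 f2 ->
  measure_preserving (m1 \x m2)%E (fun p => (f1 p.1, f2 p.2)).
Proof.
move=> f1P [mf2 f2E]; have [mf1 _] := f1P; split.
  apply/measurable_fun_pair => /=; exact: measurableT_comp.
move=> A mA; rewrite /product_measure1.
rewrite [RHS](ge0_integral_measure_preserving f1P)//; last first.
  exact: measurable_fun_xsection.
apply: eq_integral => x _ /=; rewrite -(f2E (xsection A (f1 x)));
  last exact: measurable_xsection.
by congr (m2 _); apply/seteqP; split => y; rewrite /xsection /preimage /= !inE.
Qed.

(** * Coordinatewise maps and boxes in R^d *)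

Section tuple.
Context {R : realType}.
Local Notation rR := (measurableTypeR R).

(** Each coordinate has its own map, since the coordinates of a point may lie in cells of different
    parity and position. *)
Definition tuple_map d (f : 'I_d -> R -> R) (x : d.-tuple R) : d.-tuple R :=
  [tuple f i (tnth x i) | i < d].

Lemma tuple_mapK d (f g : 'I_d -> R -> R) :
  (forall i, cancel (f i) (g i)) -> cancel (tuple_map f) (tuple_map g).
Proof. by move=> fK x; apply: eq_from_tnth => i; rewrite !tnth_mktuple fK. Qed.

(** Induction on [d]: through [cons_pair] the map is the product of the map of the first coordinate
    and that of the tail. *)
Lemma lebesgue_measure_tuple_preserving d (f : 'I_d -> R -> R) :
  (forall i, measure_preserving (@lebesgue_measure R) (f i)) ->
  measure_preserving (@lebesgue_measure_tuple R d) (tuple_map f).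
Proof.
have mf d' (f' : 'I_d' -> R -> R) :
    (forall i, measure_preserving (@lebesgue_measure R) (f' i)) ->
    measurable_fun setT (tuple_map f' : d'.-tuple rR -> d'.-tuple rR).
  move=> fP; apply/measurable_fun_tnthP => i.
  rewrite (_ : _ \o _ = f' i \o (fun x => tnth x i)); last first.
    by apply/funext => x; rewrite /= tnth_mktuple.
  apply: measurableT_comp; [exact: (fP i).1 | exact: measurable_tnth].
move=> fP; split; first exact: mf.
elim: d f fP => [|d IHd] f fP A mA.
  by congr (lebesgue_measure_tuple 0 _); apply/seteqP; split => x;
    rewrite /preimage /= [tuple_map f x]tuple0 [x]tuple0.
pose f' i := f (lift ord0 i).
have f'P : measure_preserving (@lebesgue_measure_tuple R d) (tuple_map f').
  have ? i : measure_preserving (@lebesgue_measure R) (f' i) by exact: fP.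
  by split; [exact: mf | exact: IHd].
rewrite /= /cons_measure /pushforward.
have mA' : measurable (@cons_pair R d @^-1` A).
  by rewrite -[X in measurable X]setTI; exact: measurable_cons_pair.
have -> : @cons_pair R d @^-1` (tuple_map f @^-1` A) =
    (fun p => (f ord0 p.1, tuple_map f' p.2)) @^-1` (@cons_pair R d @^-1` A).
  apply/funext => p; congr (A _); apply: eq_from_tnth => i.
  rewrite tnth_mktuple; case: (unliftP ord0 i) => [j|] ->; last by [].
  by rewrite !tnthS tnth_mktuple.
exact: (measure_preserving_prod (fP ord0) f'P).2.
Qed.

Definition box d (D : 'I_d -> set R) : set (d.-tuple R) :=
  [set x | forall i, D i (tnth x i)].

Lemma measurable_box d (D : 'I_d -> set rR) :
  (forall i, measurable (D i)) -> measurable (box D : set (d.-tuple rR)).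
Proof.
move=> mD.
rewrite (_ : box D = \big[setI/setT]_(i < d) ((fun x => tnth x i) @^-1` D i)).
  apply: bigsetI_measurable => i _; rewrite -[X in measurable X]setTI.
  exact: measurable_tnth.
rewrite -bigcap_seq; apply/seteqP; split => [x Dx i _|x Dx i]; first exact: Dx.
by apply: (Dx i); rewrite /= mem_index_enum.
Qed.

Lemma lebesgue_measure_box d (D : 'I_d -> set rR) :
  (forall i, measurable (D i)) ->
  (@lebesgue_measure_tuple R d (box D) = \prod_(i < d) lebesgue_measure (D i))%E.
Proof.
elim: d D => [|d IHd] D mD.
  rewrite big_ord0 /= diracE mem_set//; by case.
rewrite big_ord_recl /= /cons_measure /pushforward.
rewrite -IHd// -product_measure1E//; last exact: measurable_box.
congr ((_ \x _)%E _); apply/seteqP; split => [[x t] /= Dxt|[x t] /= [Dx Dt] i].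
  split => [|i]; first exact: (Dxt ord0).
  by have := Dxt (lift ord0 i); rewrite tnthS.
by case: (unliftP ord0 i) => [j|] ->; rewrite ?tnthS.
Qed.

End tuple.

(** * Lower integrals *)

Section lower_integral.
Local Open Scope ereal_scope.
Context {dT : measure_display} {T : measurableType dT} {R : realType}.
Variable mu : {measure set T -> \bar R}.
Import HBNNSimple.

(** The integral is the supremum over the simple functions below the integrand, so domination is
    only asked where [f] is positive. *)
Lemma le_lower_integral (D D' : set T) (f g : T -> \bar R) :
  (forall x, D x -> 0 <= f x) -> (forall x, D' x -> 0 <= g x) ->
  (forall x, D x -> 0 < f x -> D' x /\ f x <= g x) ->
  \int[mu]_(x in D) f x <= \int[mu]_(x in D') g x.
Proof.
move=> f0 g0 fg; rewrite !ge0_integralE//; apply: ereal_sup_le => _ [h hf <-].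
exists h => // x; apply: (le_trans (hf x)); rewrite !patchE.
case: ifPn => [/set_mem Dx|_]; last by case: ifPn => // /set_mem/g0.
have := f0 _ Dx; rewrite le_eqVlt => /predU1P[<-|fx0].
  by case: ifPn => // /set_mem/g0.
by have [D'x fgx] := fg x Dx fx0; rewrite mem_set.
Qed.

(** A simple function below [f] is cut along the pieces [E j]; each part, transported by [psi j],
    lies below [K] times [F] on [D']. Measurability is used for simple functions only, so [f] and
    [F] may be arbitrary nonnegative functions. The pieces may overlap, as only an upper bound is
    claimed. *)
Lemma integral_fold_le (I : finType) (phi psi : I -> T -> T) (E : I -> set T)
    (N D D' : set T) (f F : T -> \bar R) (K : R) :
  (forall j, measure_preserving mu (psi j)) ->
  (forall j, cancel (psi j) (phi j)) ->
  (forall j, measurable (E j)) -> measurable N -> mu N = 0 -> (0 < K)%R ->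
  (forall x, D x -> 0 <= f x) -> (forall x, D' x -> 0 <= F x) ->
  (forall x, D x -> ~ N x -> exists j, E j x) ->
  (forall x j, D x -> E j x -> D' (phi j x) /\ f x <= K%:E * F (phi j x)) ->
  \int[mu]_(x in D) f x <= (K *+ #|I|)%:E * \int[mu]_(x in D') F x.
Proof.
move=> psiP psiK mE mN N0 K0 f0 F0 cov fF.
rewrite ge0_integralE//; apply/ge_ereal_sup => _ [h hf <-].
rewrite -integralT_nnsfun.
have mh A : measurable_fun A (fun x => (h x)%:E).
  by apply: measurable_funTS; exact/measurable_EFinP/measurable_funP.
pose g j := (fun x => (h x)%:E) \_ (E j).
have g0 j x : 0 <= g j x by apply: erestrict_ge0 => y _; rewrite lee_fin.
have mg j A : measurable_fun A (g j).
  by apply: measurable_funTS; apply/(measurable_restrictT _ _).1 => //; exact: mh.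
apply: (@le_trans _ _ (\sum_(j : I) \int[mu]_x g j x)).
  (* The pieces need to cover [D] only off the null set [N], which is removed here. *)
  rewrite (@ge0_negligible_integral _ _ _ _ _ N)//; last first.
    by move=> x _; rewrite lee_fin.
  rewrite setTD -ge0_integral_sum//.
  apply: le_lower_integral => [x _|x _|x Nx hx0]; first by rewrite lee_fin.
    exact: sume_ge0.
  split=> //.
  have Dx : D x.
    apply: contrapT => nDx; have := hf x.
    by rewrite patchE memNset// leNgt hx0.
  have [j Ejx] := cov x Dx Nx.
  rewrite (bigD1 j)//= {1}/g patchE mem_set// leeDl//.
  exact: sume_ge0.
apply: (@le_trans _ _ (\sum_(j : I) (K%:E * \int[mu]_(x in D') F x))); last first.
  rewrite big_const; elim: #|I| => [|n IHn] /=; first by rewrite mulr0n mul0e.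
  have K0' := ltW K0.
  by rewrite mulrS EFinD ge0_muleDl ?leeD2l// lee_fin mulrn_wge0.
apply: lee_sum => j _.
rewrite (ge0_integral_measure_preserving (psiP j)) //.
have mpsi := (psiP j).1; have KV : K != 0%R by rewrite gt_eqF.
(* The factor [K] is pulled out of the simple function, where linearity is available, rather than
   out of the integral of [F]. *)
rewrite (_ : (fun x => _) = (fun x => K%:E * (K^-1%:E * g j (psi j x)))); last first.
  by apply/funext => x; rewrite muleA -EFinM divff// mul1e.
have gK0 x : 0 <= K^-1%:E * g j (psi j x).
  by rewrite mule_ge0// lee_fin invr_ge0 ltW.
rewrite ge0_integralZl_EFin//; last 2 first.
- by apply: measurable_funeM; exact: measurableT_comp.
- exact: ltW.
rewrite lee_pmul2l ?lte_fin//; apply: le_lower_integral => // x _.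
rewrite /g patchE; case: ifPn => [/set_mem Ex|_]; last by rewrite mule0 ltxx.
rewrite pmule_rgt0 ?lte_fin ?invr_gt0// => hx0.
have Dx : D (psi j x).
  apply: contrapT => nDx; have := hf (psi j x).
  by rewrite patchE memNset// leNgt lte_fin hx0.
have [] := fF _ _ Dx Ex; rewrite psiK => D'x fFx; split=> //.
rewrite lee_pdivrMl//; apply: le_trans fFx.
by have := hf (psi j x); rewrite patchE mem_set.
Qed.

End lower_integral.

(** * The folding map *)

Section fold.
Context {R : realType}.
Implicit Types (k : int) (u : R).

(** The isometry of the whole line that agrees with the folding map on the cell from [k] to [k + 1]:
    [u - k] for even [k], [k + 1 - u] for odd [k]. *)
Definition cell_flip k u : R :=
  reflection (odd `|k|) (if odd `|k| then (k + 1)%:~R else - k%:~R) u.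

Definition cell_unflip k : R -> R :=
  reflection (odd `|k|) (if odd `|k| then (k + 1)%:~R else k%:~R).

Lemma cell_flipK k : cancel (cell_flip k) (cell_unflip k).
Proof.
move=> u; rewrite /cell_flip /cell_unflip /reflection.
by case: (odd _); rewrite ?subKr ?subrK.
Qed.

Lemma cell_unflipK k : cancel (cell_unflip k) (cell_flip k).
Proof.
move=> u; rewrite /cell_flip /cell_unflip /reflection.
by case: (odd _); rewrite ?subKr ?addrK.
Qed.

Definition fold u : R := cell_flip (Num.floor u) u.

Lemma oddzS k : odd `|k + 1| = ~~ odd `|k|.
Proof.
case: k => n; first by rewrite -PoszD addn1 /=.
rewrite (_ : Negz n + 1 = - n%:Z); last first.
  by rewrite NegzE -addn1 PoszD opprD subrK.
by rewrite abszN /= negbK.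
Qed.

Lemma fold_id u : 0 < u < 1 -> fold u = u.
Proof.
move=> /andP[u0 u1]; have f0 : Num.floor u = 0.
  by apply: floor_def; rewrite (ltW u0) /= add0r.
by rewrite /fold /cell_flip f0 /reflection /= oppr0 addr0.
Qed.

Lemma floor_nonint u : u \isn't a Num.int ->
  (Num.floor u)%:~R < u < (Num.floor u)%:~R + 1.
Proof.
move=> uZ; rewrite -intrD1 floorD1_gt andbT lt_neqAle floor_le andbT.
by apply: contra uZ => /eqP <-; exact: intr_int.
Qed.

Lemma fold_itv01 u : u \isn't a Num.int -> 0 < fold u < 1.
Proof.
move=> /floor_nonint; rewrite /fold /cell_flip /reflection.
by case: (odd _); rewrite ?intrD => /andP[? ?]; lra.
Qed.

Lemma nonint_itv01 u : 0 < u < 1 -> u \isn't a Num.int.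
Proof.
move=> /andP[u0 u1]; apply/negP => /floorK; rewrite (_ : Num.floor u = 0).
  by move=> uE; rewrite -uE ltxx in u0.
by apply: floor_def; rewrite (ltW u0) /= add0r.
Qed.

(* An interval of length at most 1 meets at most one integer [n], and the two
   pieces are folded onto intervals with a common endpoint. *)
Lemma fold_itv (x rho : R) : 0 < rho -> exists c, [/\ 0 <= c,
  c + Num.min rho 1 <= 1 & forall u, x < u < x + rho -> u \isn't a Num.int ->
    c < fold u < c + Num.min rho 1].
Proof.
move=> rho0; case: (leP 1 rho) => [rho1|rho1].
  by exists 0; split=> [//||u _ /fold_itv01]; rewrite add0r.
set n := Num.floor x.
have nx : n%:~R <= x by exact: floor_le.
have xn : x < n%:~R + 1 by rewrite -intrD1 floorD1_gt.
have floorE u (k : int) : k%:~R <= u -> u < k%:~R + 1 -> Num.floor u = k.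
  by move=> ku uk; apply: floor_def; rewrite ku /= intrD.
have [xr|xr] := leP (x + rho) (n%:~R + 1).
  (* The interval stays in one cell: [c] is the image of its left end, or of its right end when the
     cell is reversed. *)
  exists (if odd `|n| then n%:~R + 1 - (x + rho) else x - n%:~R).
  split; [by case: ifP; lra|by case: ifP; lra|move=> u /andP[xu ux] _].
  rewrite /fold (floorE u n); [|lra|lra].
  by rewrite /cell_flip /reflection; case: (odd _) => /=; rewrite ?intrD; lra.
(* The interval crosses [n + 1], which folds to 0 for odd [n] and to 1 for even [n]; both pieces lie
   within [rho] of that endpoint. *)
exists (if odd `|n| then 0 else 1 - rho).
split; [by case: ifP; lra|by case: ifP; lra|].
move=> u /andP[xu ux] /floor_nonint/andP[fu uf].
have [un|un] := leP (n%:~R + 1) u.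
  rewrite /fold (floorE u (n + 1)); [|by rewrite intrD|by rewrite intrD; lra].
  rewrite /cell_flip /reflection oddzS.
  move: fu; rewrite (floorE u (n + 1)); [|by rewrite intrD|by rewrite intrD; lra].
  by rewrite !intrD; case: (odd _) => /=; rewrite ?intrD; lra.
move: fu; rewrite /fold (floorE u n); [|lra|lra].
by rewrite /cell_flip /reflection; case: (odd _) => /=; rewrite ?intrD; lra.
Qed.

(** The count holds because [u < x + rho] and [x < floor x + 1], while [rho < truncn rho + 1]; so
    the floors differ by less than [truncn rho + 2]. *)
Lemma floor_cell (x rho u : R) : 0 < rho -> x < u < x + rho ->
  exists j : 'I_(Num.truncn rho).+2, Num.floor u = Num.floor x + j%:Z.
Proof.
move=> rho0 /andP[xu ux].
have xf : Num.floor x <= Num.floor u by apply: le_floor; exact: ltW.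
have fE : Num.floor u = Num.floor x + `|Num.floor u - Num.floor x|%N.
  by rewrite gez0_abs ?subr_ge0// addrCA subrr addr0.
move: (`|_|%N) fE => k fE; suff lt : (k < (Num.truncn rho).+2)%N.
  by exists (Ordinal lt).
rewrite -(ltr_nat R) -[(_ .+2)%N]addn2 natrD.
have := truncnS_gt rho; have := floor_le u; have := floorD1_gt x.
rewrite fE -natr1 !intrD -pmulrn => *.
lra.
Qed.

(** Ensures that the shortened time interval and the shortened cube again form a parabolic box, of
    size [min(rho, 1)]. *)
Lemma min_sqr1 (rho : R) : 0 < rho ->
  Num.min (rho ^+ 2) 1 = Num.min rho 1 ^+ 2.
Proof.
move=> rho0; case: (leP 1 rho) => rho1.
  by rewrite expr1n min_r// expr_ge1// ltW.
by rewrite min_l// expr_le1// ltW.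
Qed.

Lemma cell_count (rho : R) : 0 < rho ->
  (Num.truncn rho).+2%:R * Num.min rho 1 <= 3 * rho.
Proof.
move=> rho0; rewrite -addn2 natrD; have [rho1|rho1] := leP 1 rho.
  have := truncn_le rho; rewrite (ltW rho0) => tr; lra.
rewrite (_ : Num.truncn rho = 0%N) ?add0r; first lra.
by apply/truncn0Pn; rewrite -ltNge.
Qed.

End fold.

(** * Integrals of folded functions over intervals and cubes *)

Section fold_integral.
Context {R : realType}.
Local Notation rR := (measurableTypeR R).

Lemma completed_lebesgue_measureE (A : set rR) : measurable A ->
  completed_lebesgue_measure A = lebesgue_measure A.
Proof. by []. Qed.

Lemma completed_lebesgue_tupleE d (A : set (d.-tuple rR)) : measurable A ->
  completed_lebesgue_tuple R d A = lebesgue_measure_tuple d A.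
Proof. by move=> mA; rewrite [LHS]measurable_mu_extE. Qed.

Definition ints : set R := [set u | u \is a Num.int].

Lemma countable_ints : countable ints.
Proof.
apply: sub_countable (countableP [set: int]).
apply: card_le_trans (card_image_le (intr : int -> R) setT).
by apply: subset_card_le => u /floorK uE; exists (Num.floor u).
Qed.

Lemma measurable_ints : measurable (ints : set rR).
Proof.
apply: countable_measurable; last exact: countable_ints.
exact: measurable_set1.
Qed.

Lemma lebesgue_measure_ints : lebesgue_measure ints = 0%E.
Proof. exact/countable_lebesgue_measure0/countable_ints. Qed.

Definition floor_fiber (k : int) : set R := [set u | Num.floor u = k].

Lemma measurable_floor_fiber k : measurable (floor_fiber k : set rR).
Proof.
rewrite (_ : floor_fiber k = `[k%:~R, (k + 1)%:~R[%classic).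
  exact: measurable_itv.
apply/seteqP; split => u; rewrite /floor_fiber /= in_itv /= -floor_eq => /eqP//.
Qed.

Definition int_hyperplanes d : set (d.-tuple R) :=
  [set x | exists i, tnth x i \is a Num.int].

Let hyperplane d (i : 'I_d) : set (d.-tuple R) :=
  box (fun j => if j == i then ints else setT).

Let int_hyperplanesE d :
  @int_hyperplanes d = \big[setU/set0]_(i < d) hyperplane i.
Proof.
rewrite -bigcup_seq; apply/seteqP; split => [x [i xi]|x [i _ xi]].
  exists i; first by rewrite /= mem_index_enum.
  by move=> j /=; case: eqP => [->|].
by exists i; have := xi i; rewrite /= eqxx.
Qed.

Let measurable_hyperplane d (i : 'I_d) :
  measurable (hyperplane i : set (d.-tuple rR)).
Proof.
by apply: measurable_box => j; case: ifP => // _; exact: measurable_ints.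
Qed.

Lemma measurable_int_hyperplanes d :
  measurable (@int_hyperplanes d : set (d.-tuple rR)).
Proof.
rewrite int_hyperplanesE; apply: bigsetU_measurable => i _.
exact: measurable_hyperplane.
Qed.

(** A finite union of boxes, each with the null set [ints] as one factor; the product vanishes even
    though the other factors are infinite. *)
Lemma lebesgue_measure_int_hyperplanes d :
  lebesgue_measure_tuple d (@int_hyperplanes d) = 0%E.
Proof.
apply/measure_negligible; first exact: measurable_int_hyperplanes.
rewrite int_hyperplanesE.
apply: (big_ind (fun A => (lebesgue_measure_tuple d).-negligible A)).
- exact: negligible_set0.
- exact: negligibleU.
move=> i _; apply/negligibleP; first exact: measurable_hyperplane.
apply: (etrans (lebesgue_measure_box _)).
  by move=> j; case: ifP => // _; exact: measurable_ints.
by rewrite (bigD1 i)//= eqxx lebesgue_measure_ints mul0e.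
Qed.

Local Open Scope ereal_scope.

(** The pieces are unit cells without the integers. The constant [K] leaves room for the factor
    produced by an inner integration. *)
Lemma integral_itv_fold_le (x rho c K : R) (f F : R -> \bar R) :
  (0 < rho)%R -> (0 < K)%R ->
  (forall u, x < u < x + rho -> u \isn't a Num.int ->
    c < fold u < c + Num.min rho 1)%R ->
  (forall u, 0 <= f u) -> (forall u, 0 <= F u) ->
  (forall u, (x < u < x + rho)%R -> u \isn't a Num.int ->
    f u <= K%:E * F (fold u)) ->
  \int[completed_lebesgue_measure]_(u in `]x, (x + rho)%R[) f u <=
  (K *+ (Num.truncn rho).+2)%:E *
  \int[completed_lebesgue_measure]_(u in `]c, (c + Num.min rho 1)%R[) F u.
Proof.
move=> rho0 K0 xc f0 F0 fF.
pose k (j : 'I_(Num.truncn rho).+2) := (Num.floor x + j%:Z)%R.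
rewrite -[X in (K *+ X)%R]card_ord.
apply: (@integral_fold_le _ _ _ completed_lebesgue_measure _
  (fun j => cell_flip (k j)) (fun j => cell_unflip (k j))
  (fun j => floor_fiber (k j) `\` ints) ints) => //.
- by move=> j; exact: completed_lebesgue_reflection.
- by move=> j; exact: cell_unflipK.
- move=> j; apply: sub_caratheodory.
  apply: measurableD; [exact: measurable_floor_fiber | exact: measurable_ints].
- apply: sub_caratheodory; exact: measurable_ints.
- exact: lebesgue_measure_ints.
- move=> u; rewrite /= in_itv /= => xu uZ.
  by have [j uj] := floor_cell rho0 xu; exists j.
- move=> u j; rewrite /= !in_itv /= => xu [uj /negP uZ].
  by have := xc _ xu uZ; have := fF _ xu uZ; rewrite /fold uj.
Qed.

(** A piece is given by one cell per coordinate, hence the [d]-th power; the finite functions [j]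
    enumerate these choices. *)
Lemma integral_cube_fold_le d (x c : d.-tuple R) (rho K : R)
    (f F : d.-tuple R -> \bar R) :
  (0 < rho)%R -> (0 < K)%R ->
  (forall i u, tnth x i < u < tnth x i + rho -> u \isn't a Num.int ->
    tnth c i < fold u < tnth c i + Num.min rho 1)%R ->
  (forall u, 0 <= f u) -> (forall u, 0 <= F u) ->
  (forall y, cube x rho y -> ~ int_hyperplanes y ->
    f y <= K%:E * F (map_tuple fold y)) ->
  \int[completed_lebesgue_tuple R d]_(y in cube x rho) f y <=
  (K *+ (Num.truncn rho).+2 ^ d)%:E *
  \int[completed_lebesgue_tuple R d]_(y in cube c (Num.min rho 1)%R) F y.
Proof.
move=> rho0 K0 xc f0 F0 fF.
pose k (j : {ffun 'I_d -> 'I_(Num.truncn rho).+2}) i :=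
  (Num.floor (tnth x i) + (j i)%:Z)%R.
have -> : ((Num.truncn rho).+2 ^ d)%N =
    #|{: {ffun 'I_d -> 'I_(Num.truncn rho).+2}}| by rewrite card_ffun !card_ord.
apply: (@integral_fold_le _ _ _ (completed_lebesgue_tuple R d) _
  (fun j => tuple_map (fun i => cell_flip (k j i)))
  (fun j => tuple_map (fun i => cell_unflip (k j i)))
  (fun j => box (fun i => floor_fiber (k j i)) `\` @int_hyperplanes d)
  (@int_hyperplanes d)) => //.
- move=> j; apply: completed_measure_preserving.
  + by apply: tuple_mapK => i; exact: cell_unflipK.
  + by apply: tuple_mapK => i; exact: cell_flipK.
  + by apply: lebesgue_measure_tuple_preserving => i; exact: lebesgue_reflection.
  + by apply: lebesgue_measure_tuple_preserving => i; exact: lebesgue_reflection.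
- by move=> j; apply: tuple_mapK => i; exact: cell_unflipK.
- move=> j; apply: caratheodory_measurable_mu_ext; apply: measurableD.
    by apply: measurable_box => i; exact: measurable_floor_fiber.
  exact: measurable_int_hyperplanes.
- by apply: caratheodory_measurable_mu_ext; exact: measurable_int_hyperplanes.
- apply: (etrans (completed_lebesgue_tupleE _)).
    exact: measurable_int_hyperplanes.
  exact: lebesgue_measure_int_hyperplanes.
- move=> y xy yZ.
  have cell i := floor_cell rho0 (xy i).
  exists [ffun i => projT1 (cid (cell i))]; split=> // i.
  by rewrite /floor_fiber /k /= ffunE; case: cid.
- move=> y j xy [yj yZ].
  have foldE : tuple_map (fun i => cell_flip (k j i)) y = map_tuple fold y.
    by apply: eq_from_tnth => i; rewrite tnth_mktuple tnth_map /fold (yj i).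
  rewrite foldE; split; last exact: fF.
  move=> i; rewrite tnth_map; apply: xc; first exact: xy.
  by apply/negP => yiZ; apply: yZ; exists i.
Qed.

End fold_integral.

(** * The extension *)

Section fold_extension.
Context {R : realType} {d : nat}.
Local Notation rR := (measurableTypeR R).
Implicit Types (p : R * d.-tuple R) (a : R * d.-tuple R -> 'M[R]_d).

Definition nonint p :=
  (p.1 \isn't a Num.int) && [forall i, tnth p.2 i \isn't a Num.int].

(** An integer coordinate folds to 0 or 1, on the boundary of the cube, where [a] is not controlled.
    There the value at the centre is taken, so that all values remain in the range of [a] on the
    cube. *)
Definition fold_extension a p :=
  if nonint p then a (fold p.1, map_tuple fold p.2)
  else a (2^-1, [tuple 2^-1 | i < d]).

Lemma unit_cube_fold p : nonint p -> unit_cube (fold p.1, map_tuple fold p.2).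
Proof.
move=> /andP[p1 /forallP p2]; split; first exact: fold_itv01.
by move=> i; rewrite tnth_map; exact: fold_itv01.
Qed.

Lemma fold_extension_id a p : unit_cube p -> fold_extension a p = a p.
Proof.
case: p => t x [/= t01 x01]; rewrite /fold_extension ifT; last first.
  apply/andP; split; first exact: nonint_itv01.
  by apply/forallP => i; exact: nonint_itv01.
rewrite fold_id//; congr (a (_, _)); apply: eq_from_tnth => i.
by rewrite tnth_map fold_id.
Qed.

Lemma fold_extension_ind (P : 'M[R]_d -> Prop) a :
  (forall p, unit_cube p -> P (a p)) -> forall p, P (fold_extension a p).
Proof.
move=> aP p; rewrite /fold_extension; case: ifPn => [/unit_cube_fold|_].
  exact: aP.
apply: aP; split=> [|i] /=; last rewrite tnth_mktuple; lra.
Qed.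

(** * Lebesgue measurability of the extension *)

Let measurable_spacetime (A : set (rR * d.-tuple rR)) :
  measurable A -> measurable (A : set (lebesgue_spacetime R d)).
Proof. exact: caratheodory_measurable_mu_ext. Qed.

Let measurable_unit_cube :
  measurable (@unit_cube R d : set (lebesgue_spacetime R d)).
Proof.
apply: measurable_spacetime.
rewrite (_ : unit_cube =
    `]0, 1[%classic `*` box (fun i : 'I_d => `]0, 1[%classic)).
  apply: measurableX; first exact: measurable_itv.
  by apply: measurable_box => i; exact: measurable_itv.
by apply/seteqP; split => -[t x] [/= t01 x01]; split=> [|i] /=;
  move: t01 (fun i => x01 i); rewrite /= ?in_itv //= => _ /(_ i); rewrite ?in_itv.
Qed.

Let measurable_nonint :
  measurable ([set p | nonint p] : set (lebesgue_spacetime R d)).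
Proof.
apply: measurable_spacetime.
rewrite (_ : [set _ | _] = (~` ints) `*` (~` @int_hyperplanes R d)).
  apply: measurableX; apply: measurableC.
    exact: measurable_ints.
  exact: measurable_int_hyperplanes.
apply/seteqP; split=> [[t x] /andP[/negP tZ /forallP xZ]|[t x] [/= tZ xZ]].
  by split=> // -[i]; exact/negP.
apply/andP; split; first exact/negP.
by apply/forallP => i; apply/negP => xi; apply: xZ; exists i.
Qed.

Let cell_index : Type := (int * {ffun 'I_d -> int})%type.

Let cell (k : cell_index) : set (lebesgue_spacetime R d) :=
  floor_fiber k.1 `*` box (fun i => floor_fiber (k.2 i)).

Let measurable_cell k : measurable (cell k).
Proof.
apply: measurable_spacetime; apply: measurableX.
  exact: measurable_floor_fiber.
by apply: measurable_box => i; exact: measurable_floor_fiber.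
Qed.

Let flip (k : cell_index) p : R * d.-tuple R :=
  (cell_flip k.1 p.1, tuple_map (fun i => cell_flip (k.2 i)) p.2).

(** The map and its inverse preserve the Borel product measure, which gives measurability for the
    completed sigma-algebra. *)
Let measurable_flip k : measurable_fun setT
  (flip k : lebesgue_spacetime R d -> lebesgue_spacetime R d).
Proof.
pose unflip p :=
  (cell_unflip k.1 p.1, tuple_map (fun i => cell_unflip (k.2 i)) p.2).
have flipP : measure_preserving (T := (rR * d.-tuple rR)%type)
    (@lebesgue_measure R \x @lebesgue_measure_tuple R d)%E (flip k).
  apply: measure_preserving_prod; first exact: lebesgue_reflection.
  by apply: lebesgue_measure_tuple_preserving => i; exact: lebesgue_reflection.
have unflipP : measure_preserving (T := (rR * d.-tuple rR)%type)
    (@lebesgue_measure R \x @lebesgue_measure_tuple R d)%E unflip.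
  apply: measure_preserving_prod; first exact: lebesgue_reflection.
  by apply: lebesgue_measure_tuple_preserving => i; exact: lebesgue_reflection.
have flipK : cancel (flip k) unflip.
  move=> [t x]; rewrite /unflip /flip /= cell_flipK; congr pair.
  by apply: tuple_mapK => i; exact: cell_flipK.
have unflipK : cancel unflip (flip k).
  move=> [t x]; rewrite /unflip /flip /= cell_unflipK; congr pair.
  by apply: tuple_mapK => i; exact: cell_unflipK.
have [mflip _] := @completed_measure_preserving _ (rR * d.-tuple rR)%type R _
  (flip k) unflip flipK unflipK flipP unflipP.
exact: mflip.
Qed.

(** Space is a countable union of cells, and on each the extension is [a] composed with one fixed
    isometry, apart from a constant on the points with an integer coordinate. *)
Lemma fold_extension_measurable a :
  lebesgue_measurable_on unit_cube a ->
  lebesgue_measurable_on setT (fold_extension a).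
Proof.
move=> ma i j.
(* The cells are enumerated by the codes of their indices; a number that codes nothing gives the
   empty set. *)
pose E n : set (lebesgue_spacetime R d) :=
  if @unpickle cell_index n is Some k then cell k else set0.
have mE n : measurable (E n).
  by rewrite /E; case: unpickle => [k|]; [exact: measurable_cell|exact: measurable0].
have -> : [set: lebesgue_spacetime R d] = \bigcup_n E n.
  apply/seteqP; split=> // -[t x] _.
  pose k : cell_index := (Num.floor t, [ffun i => Num.floor (tnth x i)]).
  exists (pickle k); first by [].
  by rewrite /E pickleK; split=> [|l] /=; last rewrite ffunE.
apply/(measurable_fun_bigcup _ mE) => n; rewrite /E.
case: unpickle => [k|]; last first.
  exact: measurable_fun_set0.
pose b : 'M[R]_d := a (2^-1, [tuple 2^-1 | i < d]).
have mk : measurable (cell k) := measurable_cell k.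
suff mflip : measurable_fun (cell k) (fun p : lebesgue_spacetime R d =>
    (if nonint p then a (flip k p) i j else b i j) : rR).
  apply: eq_measurable_fun mflip => -[t x] /set_mem[/= tk xk].
  rewrite /fold_extension /flip /=.
  case: ifP => // _; congr (a (_, _) i j); first by rewrite /fold tk.
  by apply: eq_from_tnth => l; rewrite tnth_mktuple tnth_map /fold xk.
apply: (measurable_fun_if mk).
- by apply: (measurable_fun_bool true); apply: measurableI;
    [exact: mk | exact: measurable_nonint].
- apply: (@measurable_comp _ _ _ _ _ _ (unit_cube : set (lebesgue_spacetime R d))
    (fun p => a p i j : rR)).
  + exact: measurable_unit_cube.
  + move=> _ [[t x] [[/= tk xk] tx] <-].
    have := unit_cube_fold tx; rewrite /fold /= tk /flip /=.
    rewrite (_ : map_tuple _ _ = tuple_map (fun l => cell_flip (k.2 l)) x)//.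
    by apply: eq_from_tnth => l; rewrite tnth_mktuple tnth_map xk.
  + exact: ma.
  + by apply: measurable_funS (measurable_flip k).
- exact: measurable_cst.
Qed.

End fold_extension.

(** * Oscillation over a box and over its folded image *)

Section mean_oscillation.
Context {R : realType} {d : nat}.
Implicit Types (s rho : R) (x : d.-tuple R) (a : R * d.-tuple R -> 'M[R]_d).

Definition oscillation (Qz : set R) (Qt : set (d.-tuple R)) a : \bar R :=
  (\int[completed_lebesgue_measure]_(t in Qz)
     \int[completed_lebesgue_tuple R d]_(y in Qt)
     \int[completed_lebesgue_tuple R d]_(x in Qt)
       (frobenius (a (t, x) - a (t, y)))%:E)%E.

Let frobenius_ge0 (A : 'M[R]_d) : (0 <= (frobenius A)%:E)%E.
Proof. by rewrite lee_fin sqrtr_ge0. Qed.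

Lemma oscillation_ge0 Qz Qt a : (0 <= oscillation Qz Qt a)%E.
Proof. by do 3 apply: integral_ge0 => ? _. Qed.

Lemma completed_lebesgue_time_interval s rho :
  completed_lebesgue_measure (time_interval s rho) = (rho ^+ 2)%:E.
Proof.
rewrite completed_lebesgue_measureE; last exact: measurable_itv.
rewrite /time_interval lebesgue_measure_itv /= lte_fin ltrDl.
case: ltP => [_|rho0]; first by rewrite -EFinD addrAC subrr add0r.
by congr _%:E; apply/eqP; rewrite eq_le rho0 sqr_ge0.
Qed.

Lemma completed_lebesgue_cube x rho : 0 < rho ->
  completed_lebesgue_tuple R d (cube x rho) = (rho ^+ d)%:E.
Proof.
move=> rho0.
have -> : cube x rho = box (fun i => `]tnth x i, tnth x i + rho[%classic).
  by apply/seteqP; split => y xy i; have := xy i; rewrite /= in_itv.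
have mI i : measurable
    (`]tnth x i, tnth x i + rho[%classic : set (measurableTypeR R)).
  exact: measurable_itv.
apply: (etrans (completed_lebesgue_tupleE _)); first exact: measurable_box.
apply: (etrans (lebesgue_measure_box _)); first exact: mI.
under eq_bigr => i _.
  rewrite lebesgue_measure_itv /= lte_fin ltrDl rho0 -EFinD addrAC subrr add0r.
  over.
by rewrite prodEFin big_const_ord iter_mulr_1.
Qed.

Lemma mean_oscillationE s rho x a : 0 < rho ->
  mean_oscillation (time_interval s rho) (cube x rho) a =
  (oscillation (time_interval s rho) (cube x rho) a *
   ((rho ^+ 2 * (rho ^+ d) ^+ 2)^-1)%:E)%E.
Proof.
move=> rho0; rewrite /mean_oscillation completed_lebesgue_time_interval.
rewrite completed_lebesgue_cube// -EFin_expe -EFinM inver.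
by rewrite gt_eqF// mulr_gt0// !exprn_gt0.
Qed.

(** Time, [y] and [x] are folded in turn, from the outside in; the constant of each inner estimate
    becomes the [K] of the next outer one. *)
Lemma oscillation_fold_le s s' rho x x' a :
  let r := Num.min rho 1 in
  0 < rho ->
  (forall u, s < u < s + rho ^+ 2 -> u \isn't a Num.int ->
    s' < fold u < s' + r ^+ 2) ->
  (forall i u, tnth x i < u < tnth x i + rho -> u \isn't a Num.int ->
    tnth x' i < fold u < tnth x' i + r) ->
  (oscillation (time_interval s rho) (cube x rho) (fold_extension a) <=
   (((Num.truncn rho).+2 ^ d) ^ 2 * (Num.truncn (rho ^+ 2)).+2)%:R%:E *
   oscillation (time_interval s' r) (cube x' r) a)%E.
Proof.
move=> r rho0 ss' xx'.
have rE : Num.min (rho ^+ 2) 1 = r ^+ 2 by exact: min_sqr1.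
set M := ((Num.truncn rho).+2 ^ d)%N.
have M0 : 0 < M%:R :> R by rewrite ltr0n expn_gt0.
(* The constant in nested form: one [M] from each of the two space integrals, then the number of
   time cells. *)
rewrite (_ : (_ * _)%:R = M%:R *+ M *+ (Num.truncn (rho ^+ 2)).+2); last first.
  by rewrite -!mulrnA -mulnn -?mulnA.
rewrite /oscillation /time_interval -rE.
apply: integral_itv_fold_le.
- exact: exprn_gt0.
- by rewrite pmulrn_rgt0// -(ltr0n R).
- by rewrite rE.
- by move=> t; do 2 apply: integral_ge0 => ? _.
- by move=> t; do 2 apply: integral_ge0 => ? _.
move=> t _ tZ; apply: integral_cube_fold_le => //.
- by move=> y; apply: integral_ge0.
- by move=> y; apply: integral_ge0.
(* Here [K] is 1: off the integer hyperplanes the integrand equals its folded form. *)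
move=> y _ yZ; apply: (@integral_cube_fold_le _ _ _ _ _ 1 _
  (fun z => (frobenius (a (fold t, z) - a (fold t, map_tuple fold y)))%:E)) => //.
have nonintE z : ~ int_hyperplanes z ->
    fold_extension a (t, z) = a (fold t, map_tuple fold z).
  move=> zZ; rewrite /fold_extension ifT//; apply/andP; split=> //.
  by apply/forallP => i; apply/negP => zi; apply: zZ; exists i.
by move=> z _ zZ; rewrite mul1e !nonintE.
Qed.

End mean_oscillation.

(** * Comparison of the seminorms *)

Unset Implicit Arguments.

Theorem corollary2p5 (R : realType) (d : nat) (hd : (1 <= d)%N)
  (delta : R) (hdelta : 0 < delta <= 1)
  (a : R * d.-tuple R -> 'M[R]_d)
  (hmeas : lebesgue_measurable_on unit_cube a)
  (ha : forall p, unit_cube p -> Sdelta delta (a p))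
  (hbmo : BMOx 1%E unit_cube a) :
  exists ahat : R * d.-tuple R -> 'M[R]_d,
    [/\ lebesgue_measurable_on setT ahat,
        forall p, Sdelta delta (ahat p),
        forall p, unit_cube p -> ahat p = a p &
        (sharp_seminorm +oo setT ahat
           <= (3 ^+ (2 + 2 * d))%:E * sharp_seminorm 1 unit_cube a)%E].
Proof.
exists (fold_extension a); split.
- exact: fold_extension_measurable.
- exact: (fold_extension_ind (P := Sdelta delta)).
- exact: fold_extension_id.
apply/ge_ereal_sup => _ [rho [s [x [rho0 _ _ ->]]]].
set r := Num.min rho 1.
have r0 : 0 < r by rewrite lt_min rho0 ltr01.
have r1 : r <= 1 by rewrite ge_min lexx orbT.
have rE : Num.min (rho ^+ 2) 1 = r ^+ 2 by exact: min_sqr1.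
have [s' [s'0 s'1 ss']] := fold_itv s (exprn_gt0 2 rho0).
rewrite rE in s'1 ss'.
have /choice[c cP] := fun i : 'I_d => fold_itv (tnth x i) rho0.
pose x' := [tuple c i | i < d].
have xx' i u : tnth x i < u < tnth x i + rho -> u \isn't a Num.int ->
    tnth x' i < fold u < tnth x' i + r.
  by rewrite tnth_mktuple; case: (cP i) => _ _; exact.
(* The folded box has size [r <= 1] and lies in the unit cube, so it competes in the seminorm of
   [a]; it remains to compare two mean oscillations. *)
apply: (@le_trans _ _ ((3 ^+ (2 + 2 * d))%:E *
    mean_oscillation (time_interval s' r) (cube x' r) a)%E); last first.
  rewrite lee_pmul2l ?lte_fin ?exprn_gt0//; apply: ereal_sup_ubound.
  exists r, s', x'; split=> //.
  move=> [t y] [+ xy]; rewrite /time_interval /= in_itv /= => st.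
  split=> [|i] /=; first by lra.
  have := xy i; rewrite tnth_mktuple; case: (cP i) => + + _.
  by rewrite -/r; lra.
rewrite !mean_oscillationE//.
have cd : ((Num.truncn rho).+2 ^ d)%:R * r ^+ d <= 3 ^+ d * rho ^+ d.
  rewrite natrX -!exprMn; apply: lerXn2r; last exact: cell_count.
    by rewrite nnegrE mulr_ge0// ltW.
  by rewrite nnegrE mulr_ge0// ltW.
have ct := cell_count (exprn_gt0 2 rho0); rewrite rE in ct.
have := oscillation_fold_le a rho0 ss' xx'.
have M0 : 0 <= ((Num.truncn rho).+2 ^ d)%:R :> R by [].
have m0 : 0 <= (Num.truncn (rho ^+ 2)).+2%:R :> R by [].
rewrite natrM natrX; move: _%:R M0 cd (_%:R) m0 ct => M M0 cd m m0 ct NN'.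
apply: le_trans (lee_wpmul2r _ NN') _.
  by rewrite lee_fin invr_ge0 mulr_ge0// ?exprn_ge0// ltW.
rewrite -/r; set N' := oscillation _ _ _.
rewrite [((M ^+ 2 * m)%:E * N')%E]muleC -muleA [leRHS]muleCA -!EFinM.
apply: lee_wpmul2l; [exact: oscillation_ge0 | rewrite lee_fin].
have V0 (z : R) : 0 < z -> 0 < z ^+ 2 * (z ^+ d) ^+ 2.
  by move=> z0; rewrite mulr_gt0// !exprn_gt0.
(* With the volumes cleared, [m * M ^+ 2] times the volume product of size [r] must be at most
   [3 ^+ (2 + 2 * d)] times that of size [rho]. This follows from [ct] and the square of [cd]. *)
rewrite ler_pdivrMr ?V0// [leRHS]mulrAC ler_pdivlMr ?V0//.
rewrite [M ^+ 2 * m]mulrC mulrACA -exprMn.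
apply: (@le_trans _ _ ((3 * rho ^+ 2) * (3 ^+ d * rho ^+ d) ^+ 2)).
  apply: ler_pM => //; [by rewrite mulr_ge0// sqr_ge0 | exact: sqr_ge0 |].
  apply: lerXn2r => //; rewrite nnegrE mulr_ge0// ?exprn_ge0// ltW//.
(* The counting gives [3 ^+ (1 + 2 * d)]; one factor 3 is left over and is discarded at the end. *)
rewrite exprMn mulrACA [X in _ <= X * _](_ : _ = 3 * (3 * 3 ^+ d ^+ 2)); last first.
  by rewrite exprD mulnC exprM mulrA -expr2.
apply: ler_wpM2r; first exact/ltW/V0.
by apply: ler_wpM2l => //; rewrite ler_peMl ?sqr_ge0// ler1n.
Qed.
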